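(* Let $\mathbb A$ be a distributive monoidal category. For any $f:A\to C$ and $g:B\to C$ in $\mathbb A$, with copairing $[f,g]:A\oplus B\to C$ in $\mathbb A$, we have $\left[\ulcorner f\urcorner,\ulcorner g\urcorner\right]=\ulcorner [f,g]\urcorner$ in the free cornering with choice $\ulcorner\mathbb A\urcorner^{\oplus}$.
   Context: Monoidal categories are strict, and composites are in diagrammatic order ($fg$ is first $f$, then $g$). A single-object double category $\mathbb D$ has a horizontal edge monoid $(\mathbb D_H,\otimes,I)$, a vertical edge monoid $(\mathbb D_V,\otimes,I)$, and for $A,B\in\mathbb D_H$, $U,W\in\mathbb D_V$ a set of cells $(U;A;B;W)$ (left; top; bottom; right boundary). For $\alpha:(U;A;B;V)$ and $\beta:(V;A';B';W)$ there is a horizontal composite $\alpha\mid\beta:(U;A\otimes A';B\otimes B';W)$; for $\alpha:(U;A;C;W)$ and $\beta:(U';C;B;W')$ a vertical composite $\frac{\alpha}{\beta}:(U\otimes U';A;B;W\otimes W')$. Both are associative and unital, with horizontal units $id_U:(U;I;I;U)$ and vertical units $1_A:(I;A;A;I)$, where $id_I=1_I$, $1_{A\otimes B}=1_A\mid 1_B$, $id_{U\otimes W}=\frac{id_U}{id_W}$, and interchange $\frac{\alpha}{\beta}\mid\frac{\gamma}{\delta}=\frac{\alpha\mid\gamma}{\beta\mid\delta}$ holds. A distributive monoidal category $(\mathbb A,\otimes,\oplus,I)$ is a symmetric monoidal category with binary coproducts $A\oplus B$ (injections $\sigma_0,\sigma_1$, copairing $[f,g]$; no initial object required) such that $[\sigma_0\otimes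 1_C,\sigma_1\otimes 1_C]:(A\otimes C)\oplus(B\otimes C)\to(A\oplus B)\otimes C$ is invertible for all $A,B,C$. Exchanges with choice: $\mathbb A^{\circ\bullet}_\oplus$ is the monoid (operation $\otimes$, unit $I$) with elements generated by $A^\circ$, $A^\bullet$ ($A\in\mathbb A_0$), $I$, $U\otimes W$, $U\times W$, $U+W$, subject only to associativity and unitality of $\otimes$. Free cornering with choice: $\ulcorner\mathbb A\urcorner^{\oplus}$ is the free single-object double category with horizontal edge monoid $(\mathbb A_0,\otimes,I)$, vertical edge monoid $\mathbb A^{\circ\bullet}_\oplus$, and generating cells and equations: (1) for each $f:A\to B$ in $\mathbb A$ a cell $\ulcorner f\urcorner:(I;A;B;I)$ (also written $f$), with $\ulcorner fg\urcorner=\frac{\ulcorner f\urcorner}{\ulcorner g\urcorner}$, $\ulcorner 1_A\urcorner=1_A$, $\ulcorner f\otimes g\urcorner=\ulcorner f\urcorner\mid\ulcorner g\urcorner$; (2) for each $A\in\mathbb A_0$ corner cells $\mathsf{get}_L^A:(A^\circ;I;A;I)$, $\mathsf{put}_R^A:(I;A;I;A^\circ)$, $\mathsf{get}_R^A:(I;I;A;A^\bullet)$, $\mathsf{put}_L^A:(A^\bullet;A;I;I)$ with $\mathsf{put}_R^A\mid\mathsf{get}_L^A=1_A$, $\frac{\mathsf{get}_L^A}{\mathsf{put}_R^A}=id_{A^\circ}$, $\mathsf{get}_R^A\mid\mathsf{put}_L^A=1_A$, $\frac{\mathsf{get}_R^A}{\mathsf{put}_L^A}=id_{A^\bullet}$;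 (3) for all $U,W$, cells $\pi_0:(U\times W;I;I;U)$, $\pi_1:(U\times W;I;I;W)$, and for $\alpha:(V;A;B;U)$, $\beta:(V;A;B;W)$ a unique cell $\alpha\times\beta:(V;A;B;U\times W)$ with $(\alpha\times\beta)\mid\pi_0=\alpha$, $(\alpha\times\beta)\mid\pi_1=\beta$; (4) for all $U,W$, cells $\iota_0:(U;I;I;U+W)$, $\iota_1:(W;I;I;U+W)$, and for $\alpha:(U;A;B;V)$, $\beta:(W;A;B;V)$ a unique cell $\alpha+\beta:(U+W;A;B;V)$ with $\iota_0\mid(\alpha+\beta)=\alpha$, $\iota_1\mid(\alpha+\beta)=\beta$; (5) for $\alpha:(U;A;C;W)$, $\beta:(U;B;C;W)$ a unique cell $[\alpha,\beta]:(U;A\oplus B;C;W)$ with $\frac{\ulcorner\sigma_0\urcorner}{[\alpha,\beta]}=\alpha$, $\frac{\ulcorner\sigma_1\urcorner}{[\alpha,\beta]}=\beta$. *)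

(* Defs.v *)
From Stdlib Require Import List.
Import ListNotations.

Set Implicit Arguments.
Unset Strict Implicit.
Unset Printing Implicit Defensive.

Declare Scope cat_scope.
Delimit Scope cat_scope with cat.
Local Open Scope cat_scope.

Record category := Category {
  ob :> Type;
  hom : ob -> ob -> Type;
  idm : forall X, hom X X;
  comp : forall X Y Z, hom X Y -> hom Y Z -> hom X Z;
  comp1m : forall X Y (f : hom X Y), comp (idm X) f = f;
  compm1 : forall X Y (f : hom X Y), comp f (idm Y) = f;
  compA : forall W X Y Z (f : hom W X) (g : hom X Y) (h : hom Y Z),
    comp f (comp g h) = comp (comp f g) h }.

Arguments idm {c} X.

(* Diagrammatic order: first f, then g. *)
Notation "f ;; g" := (comp f g) (at level 50, left associativity) : cat_scope.

Definition eqhom (C : category) (X Y : C) (e : X = Y) : hom X Y :=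
  match e in _ = Y' return hom X Y' with eq_refl => idm X end.

(* Objects form a monoid for Leibniz equality. The associator and the unitors
   are the identities, typed by transport along the monoid laws (eqhom); their
   naturality says that the tensor of morphisms is strictly associative and
   unital. *)
Record strict_monoidal := StrictMonoidal {
  smc :> category;
  munit : smc;
  tens : smc -> smc -> smc;
  tensA : forall X Y Z, tens X (tens Y Z) = tens (tens X Y) Z;
  tens1o : forall X, tens munit X = X;
  tenso1 : forall X, tens X munit = X;
  tensm : forall X X' Y Y' : smc,
    hom X Y -> hom X' Y' -> hom (tens X X') (tens Y Y');
  tensm_id : forall X Y, tensm (idm X) (idm Y) = idm (tens X Y);
  tensm_comp : forall X Y Z X' Y' Z' (f : hom X Y) (g : hom Y Z)
      (f' : hom X' Y') (g' : hom Y' Z'),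
    tensm (f ;; g) (f' ;; g') = tensm f f' ;; tensm g g';
  tensmA : forall X X' Y Y' Z Z' (f : hom X X') (g : hom Y Y') (h : hom Z Z'),
    tensm f (tensm g h) ;; eqhom (tensA X' Y' Z')
    = eqhom (tensA X Y Z) ;; tensm (tensm f g) h;
  tens1m : forall X Y (f : hom X Y),
    tensm (idm munit) f ;; eqhom (tens1o Y) = eqhom (tens1o X) ;; f;
  tensm1 : forall X Y (f : hom X Y),
    tensm f (idm munit) ;; eqhom (tenso1 Y) = eqhom (tenso1 X) ;; f }.

Arguments munit {s}.

Notation "X ⊗ Y" := (tens X Y) (at level 40, left associativity) : cat_scope.
Notation "f ⊗m g" := (tensm f g) (at level 40, left associativity) : cat_scope.

(* The second hexagon and the unit coherence of the braiding follow from the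
   axioms below. *)
Record symmetric_monoidal := SymmetricMonoidal {
  symc :> strict_monoidal;
  braid : forall X Y : symc, hom (X ⊗ Y) (Y ⊗ X);
  braid_nat : forall (X X' Y Y' : symc) (f : hom X X') (g : hom Y Y'),
    (f ⊗m g) ;; braid X' Y' = braid X Y ;; (g ⊗m f);
  braidK : forall X Y, braid X Y ;; braid Y X = idm (X ⊗ Y);
  braid_hexagon : forall X Y Z,
    eqhom (tensA X Y Z) ;; (braid X Y ⊗m idm Z) ;;
      eqhom (eq_sym (tensA Y X Z)) ;; (idm Y ⊗m braid X Z) ;;
      eqhom (tensA Y Z X)
    = braid X (Y ⊗ Z) }.

Definition invertible (C : category) (X Y : C) (f : hom X Y) : Prop :=
  exists g : hom Y X, f ;; g = idm X /\ g ;; f = idm Y.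

Record distributive_monoidal := DistributiveMonoidal {
  dmc :> symmetric_monoidal;
  osum : dmc -> dmc -> dmc;
  inj0 : forall X Y, hom X (osum X Y);
  inj1 : forall X Y, hom Y (osum X Y);
  copair : forall X Y Z, hom X Z -> hom Y Z -> hom (osum X Y) Z;
  inj0_copair : forall X Y Z (f : hom X Z) (g : hom Y Z),
    inj0 X Y ;; copair f g = f;
  inj1_copair : forall X Y Z (f : hom X Z) (g : hom Y Z),
    inj1 X Y ;; copair f g = g;
  copair_uniq : forall X Y Z (f : hom X Z) (g : hom Y Z) (h : hom (osum X Y) Z),
    inj0 X Y ;; h = f -> inj1 X Y ;; h = g -> h = copair f g;
  distributive : forall X Y Z : dmc,
    invertible (copair (inj0 X Y ⊗m idm Z) (inj1 X Y ⊗m idm Z)) }.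

Arguments inj0 {d} X Y.
Arguments inj1 {d} X Y.

Notation "X ⊕ Y" := (osum X Y) (at level 50, left associativity) : cat_scope.

(* Since (⊗, I) is subject only to associativity and unitality, the monoid of
   exchanges is the free monoid on the generators other than I and ⊗: lists of
   these, with concatenation as ⊗ and [] as I. *)
Inductive exchange_gen (O : Type) : Type :=
| white (X : O)
| black (X : O)
| xprod_gen (U W : list (exchange_gen O))
| xsum_gen (U W : list (exchange_gen O)).

Definition exchange (O : Type) := list (exchange_gen O).

Notation "X °" := [white X] (at level 2, format "X °") : cat_scope.
Notation "X •" := [black X] (at level 2, format "X •") : cat_scope.
Notation "U ×x W" := [xprod_gen U W] (at level 40, left associativity) : cat_scope.
Notation "U +x W" := [xsum_gen U W] (at level 50, left associativity) : cat_scope.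

(* cell U X Y W: terms for the cells (U; X; Y; W), boundaries being listed as
   left, top, bottom, right. *)
Inductive cell (A : distributive_monoidal) :
    exchange A -> A -> A -> exchange A -> Type :=
| hcomp : forall U V W (X X' Y Y' : A),
    cell U X Y V -> cell V X' Y' W -> cell U (X ⊗ X') (Y ⊗ Y') W
| vcomp : forall U U' W W' (X Y Z : A),
    cell U X Z W -> cell U' Z Y W' -> cell (U ++ U') X Y (W ++ W')
| hid : forall U, cell U munit munit U
| vid : forall X, cell [] X X []
| corner : forall X Y : A, hom X Y -> cell [] X Y []
| getL : forall X, cell (X°) munit X []
| putR : forall X, cell [] X munit (X°)
| getR : forall X, cell [] munit X (X•)
| putL : forall X, cell (X•) X munit []
| proj0 : forall U W, cell (U ×x W) munit munit U
| proj1 : forall U W, cell (U ×x W) munit munit W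
| cprod : forall U V W (X Y : A),
    cell V X Y U -> cell V X Y W -> cell V X Y (U ×x W)
| cinj0 : forall U W, cell U munit munit (U +x W)
| cinj1 : forall U W, cell W munit munit (U +x W)
| csum : forall U V W (X Y : A),
    cell U X Y V -> cell W X Y V -> cell (U +x W) X Y V
| ccopair : forall U W (X Y Z : A),
    cell U X Z W -> cell U Y Z W -> cell U (X ⊕ Y) Z W.

Arguments hid {A} U.
Arguments vid {A} X.
Arguments getL {A} X.
Arguments putR {A} X.
Arguments getR {A} X.
Arguments putL {A} X.
Arguments proj0 {A} U W.
Arguments proj1 {A} U W.
Arguments cinj0 {A} U W.
Arguments cinj1 {A} U W.

Notation "'⌜' f '⌝'" := (corner f) (at level 0, f at level 99) : cat_scope.
Notation "a ∣ b" := (hcomp a b) (at level 45, left associativity) : cat_scope.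
Notation "a ⊘ b" := (vcomp a b) (at level 42, left associativity) : cat_scope.

Reserved Notation "a ≈ b" (at level 70, no associativity).

(* Equality of cells in the free cornering with choice: the least congruence
   containing the equations. The two sides of, e.g., associativity have boundary
   expressions that are equal but not convertible, so the relation is
   heterogeneous; it only relates cells with equal boundaries (ceq_boundary). *)
Inductive ceq (A : distributive_monoidal) :
    forall U X Y W, cell (A := A) U X Y W ->
    forall U' X' Y' W', cell (A := A) U' X' Y' W' -> Prop :=
| ceq_refl : forall U W (X Y : A) (a : cell U X Y W), a ≈ a
| ceq_sym : forall U W (X Y : A) (a : cell U X Y W)
    U' W' (X' Y' : A) (b : cell U' X' Y' W'), a ≈ b -> b ≈ a
| ceq_trans : forall U W (X Y : A) (a : cell U X Y W)
    U' W' (X' Y' : A) (b : cell U' X' Y' W')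
    U'' W'' (X'' Y'' : A) (c : cell U'' X'' Y'' W''), a ≈ b -> b ≈ c -> a ≈ c
| ceq_hcomp : forall U V W (X X' Y Y' : A)
    (a : cell U X Y V) (b : cell V X' Y' W)
    U2 V2 W2 (X2 X2' Y2 Y2' : A)
    (a2 : cell U2 X2 Y2 V2) (b2 : cell V2 X2' Y2' W2),
    a ≈ a2 -> b ≈ b2 -> a ∣ b ≈ a2 ∣ b2
| ceq_vcomp : forall U U' W W' (X Y Z : A)
    (a : cell U X Z W) (b : cell U' Z Y W')
    U2 U2' W2 W2' (X2 Y2 Z2 : A)
    (a2 : cell U2 X2 Z2 W2) (b2 : cell U2' Z2 Y2 W2'),
    a ≈ a2 -> b ≈ b2 -> a ⊘ b ≈ a2 ⊘ b2
| ceq_cprod : forall U V W (X Y : A) (a : cell V X Y U) (b : cell V X Y W)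
    U2 V2 W2 (X2 Y2 : A) (a2 : cell V2 X2 Y2 U2) (b2 : cell V2 X2 Y2 W2),
    a ≈ a2 -> b ≈ b2 -> cprod a b ≈ cprod a2 b2
| ceq_csum : forall U V W (X Y : A) (a : cell U X Y V) (b : cell W X Y V)
    U2 V2 W2 (X2 Y2 : A) (a2 : cell U2 X2 Y2 V2) (b2 : cell W2 X2 Y2 V2),
    a ≈ a2 -> b ≈ b2 -> csum a b ≈ csum a2 b2
| ceq_ccopair : forall U W (X Y Z : A) (a : cell U X Z W) (b : cell U Y Z W)
    U2 W2 (X2 Y2 Z2 : A) (a2 : cell U2 X2 Z2 W2) (b2 : cell U2 Y2 Z2 W2),
    a ≈ a2 -> b ≈ b2 -> ccopair a b ≈ ccopair a2 b2
| hcompA : forall U V V' W (X X' X'' Y Y' Y'' : A)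
    (a : cell U X Y V) (b : cell V X' Y' V') (c : cell V' X'' Y'' W),
    a ∣ (b ∣ c) ≈ (a ∣ b) ∣ c
| hcomp1c : forall U W (X Y : A) (a : cell U X Y W), hid U ∣ a ≈ a
| hcompc1 : forall U W (X Y : A) (a : cell U X Y W), a ∣ hid W ≈ a
| vcompA : forall U U' U'' W W' W'' (X Y Y' Z : A)
    (a : cell U X Y W) (b : cell U' Y Y' W') (c : cell U'' Y' Z W''),
    a ⊘ (b ⊘ c) ≈ (a ⊘ b) ⊘ c
| vcomp1c : forall U W (X Y : A) (a : cell U X Y W), vid X ⊘ a ≈ a
| vcompc1 : forall U W (X Y : A) (a : cell U X Y W), a ⊘ vid Y ≈ a
| hid_unit : hid (A := A) [] ≈ vid (A := A) munit
| vid_tens : forall X Y : A, vid (X ⊗ Y) ≈ vid X ∣ vid Y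
| hid_tens : forall U W : exchange A, hid (U ++ W) ≈ hid U ⊘ hid W
| interchange : forall U U' V V' W W' (X Y Z X' Y' Z' : A)
    (a : cell U X Z V) (b : cell U' Z Y V')
    (c : cell V X' Z' W) (d : cell V' Z' Y' W'),
    (a ⊘ b) ∣ (c ⊘ d) ≈ (a ∣ c) ⊘ (b ∣ d)
| corner_comp : forall (X Y Z : A) (f : hom X Y) (g : hom Y Z),
    ⌜f ;; g⌝ ≈ ⌜f⌝ ⊘ ⌜g⌝
| corner_id : forall X : A, ⌜idm X⌝ ≈ vid X
| corner_tens : forall (X X' Y Y' : A) (f : hom X Y) (g : hom X' Y'),
    ⌜f ⊗m g⌝ ≈ ⌜f⌝ ∣ ⌜g⌝
| putR_getL : forall X : A, putR X ∣ getL X ≈ vid X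
| getL_putR : forall X : A, getL X ⊘ putR X ≈ hid (A := A) (X°)
| getR_putL : forall X : A, getR X ∣ putL X ≈ vid X
| getR_putL_v : forall X : A, getR X ⊘ putL X ≈ hid (A := A) (X•)
| cprod_proj0 : forall U V W (X Y : A) (a : cell V X Y U) (b : cell V X Y W),
    cprod a b ∣ proj0 U W ≈ a
| cprod_proj1 : forall U V W (X Y : A) (a : cell V X Y U) (b : cell V X Y W),
    cprod a b ∣ proj1 U W ≈ b
| cprod_uniq : forall U V W (X Y : A) (a : cell V X Y U) (b : cell V X Y W)
    (c : cell V X Y (U ×x W)),
    c ∣ proj0 U W ≈ a -> c ∣ proj1 U W ≈ b -> c ≈ cprod a b
| cinj0_csum : forall U V W (X Y : A) (a : cell U X Y V) (b : cell W X Y V),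
    cinj0 U W ∣ csum a b ≈ a
| cinj1_csum : forall U V W (X Y : A) (a : cell U X Y V) (b : cell W X Y V),
    cinj1 U W ∣ csum a b ≈ b
| csum_uniq : forall U V W (X Y : A) (a : cell U X Y V) (b : cell W X Y V)
    (c : cell (U +x W) X Y V),
    cinj0 U W ∣ c ≈ a -> cinj1 U W ∣ c ≈ b -> c ≈ csum a b
| inj0_ccopair : forall U W (X Y Z : A) (a : cell U X Z W) (b : cell U Y Z W),
    ⌜inj0 X Y⌝ ⊘ ccopair a b ≈ a
| inj1_ccopair : forall U W (X Y Z : A) (a : cell U X Z W) (b : cell U Y Z W),
    ⌜inj1 X Y⌝ ⊘ ccopair a b ≈ b
| ccopair_uniq : forall U W (X Y Z : A) (a : cell U X Z W) (b : cell U Y Z W)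
    (c : cell U (X ⊕ Y) Z W),
    ⌜inj0 X Y⌝ ⊘ c ≈ a -> ⌜inj1 X Y⌝ ⊘ c ≈ b -> c ≈ ccopair a b
where "a ≈ b" := (ceq a b) : cat_scope.

Lemma ceq_boundary (A : distributive_monoidal) U W (X Y : A) (a : cell U X Y W)
    U' W' (X' Y' : A) (b : cell U' X' Y' W') :
  a ≈ b -> U = U' /\ X = X' /\ Y = Y' /\ W = W'.
Proof.
induction 1; repeat match goal with H : _ /\ _ |- _ => destruct H end;
  subst; repeat split; simpl;
  rewrite ?tensA, ?tens1o, ?tenso1, ?app_assoc, ?app_nil_r; reflexivity.
Qed.

(* Main.v *)
Require Import Defs.

Local Open Scope cat_scope.

(** The corner map preserves vertical composition, so it carries the two equations defining
    [copair f g] in [A] to equations between cells: [⌜copair f g⌝] restricts to [⌜f⌝] and [⌜g⌝]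
    along the corners of the injections. Uniqueness of the cell copairing then identifies the
    two. *)
Theorem lemma7 (A : distributive_monoidal) (X Y Z : A)
    (f : hom X Z) (g : hom Y Z) :
  ccopair ⌜f⌝ ⌜g⌝ ≈ ⌜copair f g⌝.
Proof.
pose proof (corner_comp (inj0 X Y) (copair f g)) as H0.
pose proof (corner_comp (inj1 X Y) (copair f g)) as H1.
rewrite inj0_copair in H0.
rewrite inj1_copair in H1.
exact (ceq_sym (ccopair_uniq (ceq_sym H0) (ceq_sym H1))).
Qed.
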